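(* Let $p=2$. Let $g:\mathbb{R}^n\to\mathbb{R}\cup\{+\infty\}$ be proper, lower semicontinuous, and high-order prox-bounded of order $p=2$ with threshold $\gamma^{g,p}>0$. Let $f:\mathbb{R}^n\to\mathbb{R}$ be Fréchet differentiable with $L$-Lipschitz continuous gradient on $\mathbb{R}^n$, and set $\varphi:=f+g$. Then, for each $r>0$, there exists $\overline{\gamma}_r\in(0,\gamma^{g,p})$ such that, for every $\gamma\in(0,\overline{\gamma}_r)$, there exists a constant $\mathcal{L}_{r,\gamma}>0$ satisfying $$|\varphi_\gamma^p(z)-\varphi_\gamma^p(x)|\le\mathcal{L}_{r,\gamma}\|z-x\|,\qquad\forall x,z\in\mathbf{B}(0;r).$$
   Context: $\|\cdot\|$ and $\langle\cdot,\cdot\rangle$ are the Euclidean norm and inner product on $\mathbb{R}^n$; $\mathbf{B}(\overline{x};r)$ is the open ball with center $\overline{x}$ and radius $r$. A function $h:\mathbb{R}^n\to\mathbb{R}\cup\{+\infty\}$ is proper if it is finite at some point. A proper function $g$ is high-order prox-bounded of order $p>1$ if there exist $\gamma>0$ and $x\in\mathbb{R}^n$ with $\inf_{y\in\mathbb{R}^n}\{g(y)+\frac{1}{p\gamma}\|x-y\|^p\}>-\infty$; the supremum of all such $\gamma$ is the threshold $\gamma^{g,p}\in(0,+\infty]$. For $\gamma>0$, the high-order forward-backward envelope of $\varphi=f+g$ is $$\varphi_\gamma^p(x):=\inf_{y\in\mathbb{R}^n}\left\{f(x)+\langle\nabla f(x),y-x\rangle+g(y)+\frac{1}{p\gamma}\|x-y\|^p\right\}.$$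 *)

(* Defs.v *)
From HB Require Import structures.
From mathcomp Require Import all_boot all_order all_algebra.
From mathcomp Require Import all_classical all_reals all_analysis.

Set Implicit Arguments.
Unset Strict Implicit.
Unset Printing Implicit Defensive.
Import Order.TTheory GRing.Theory Num.Theory.
Import numFieldNormedType.Exports.
Local Open Scope classical_set_scope.
Local Open Scope ring_scope.

(* R^n is the type 'rV[R]_n of row vectors. The library norm `|x| on 'rV[R]_n
   is the sup norm, so the Euclidean inner product, norm and balls are defined
   here. Topological notions ([lower_semicontinuous], [differentiable]) are the
   library's: they do not depend on the choice of norm in finite dimension. *)

Definition edot (R : realType) (n : nat) (u v : 'rV[R]_n) : R :=
  \sum_(i < n) u 0 i * v 0 i.

Definition enorm (R : realType) (n : nat) (u : 'rV[R]_n) : R :=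
  Num.sqrt (edot u u).

Definition eball (R : realType) (n : nat) (c : 'rV[R]_n) (r : R) :
    set 'rV[R]_n :=
  [set x | enorm (x - c) < r].

(* Vector representing the Frechet differential, see [edot_grad]. *)
Definition grad (R : realType) (n : nat) (f : 'rV[R]_n -> R) (x : 'rV[R]_n) :
    'rV[R]_n :=
  \row_(j < n) 'd f x (delta_mx 0 j).

Lemma edot_grad (R : realType) (n : nat) (f : 'rV[R]_n -> R)
    (x v : 'rV[R]_n) :
  edot (grad f x) v = 'd f x v.
Proof.
rewrite {2}(row_sum_delta v) linear_sum; apply: eq_bigr => i _.
by rewrite linearZ mxE mulrC.
Qed.

Definition grad_lipschitz (R : realType) (n : nat) (L : R)
    (f : 'rV[R]_n -> R) : Prop :=
  forall x y : 'rV[R]_n, enorm (grad f x - grad f y) <= L * enorm (x - y).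

(* Functions into R \cup {+oo} are functions into \bar R that avoid -oo. *)
Definition proper_efun (R : realType) (n : nat) (g : 'rV[R]_n -> \bar R) :
    Prop :=
  (forall x, g x != -oo%E) /\ exists x, g x \is a fin_num.

Definition moreau_inf (R : realType) (n : nat) (p : R) (g : 'rV[R]_n -> \bar R)
    (gamma : R) (x : 'rV[R]_n) : \bar R :=
  ereal_inf (range (fun y : 'rV[R]_n =>
    (g y + (1 / (p * gamma) * enorm (x - y) `^ p)%:E)%E)).

Definition prox_radii (R : realType) (n : nat) (p : R)
    (g : 'rV[R]_n -> \bar R) : set R :=
  [set gamma | 0 < gamma /\ exists x, (-oo < moreau_inf p g gamma x)%E].

Definition ho_prox_bounded (R : realType) (n : nat) (p : R)
    (g : 'rV[R]_n -> \bar R) : Prop :=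
  exists gamma, prox_radii p g gamma.

Definition prox_threshold (R : realType) (n : nat) (p : R)
    (g : 'rV[R]_n -> \bar R) : \bar R :=
  ereal_sup [set gamma%:E | gamma in prox_radii p g].

(* High-order forward-backward envelope of f + g. It is [\bar R]-valued; since
   (-oo) - (-oo) = (+oo) - (+oo) = -oo in [\bar R], a finite upper bound on
   [`|hofbe p f g gamma z - hofbe p f g gamma x|] entails that both values are
   finite. *)
Definition hofbe (R : realType) (n : nat) (p : R) (f : 'rV[R]_n -> R)
    (g : 'rV[R]_n -> \bar R) (gamma : R) (x : 'rV[R]_n) : \bar R :=
  ereal_inf (range (fun y : 'rV[R]_n =>
    ((f x + edot (grad f x) (y - x))%:E + g y
     + (1 / (p * gamma) * enorm (x - y) `^ p)%:E)%E)).

(* Main.v *)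
(* Write [hofbe 2 f g gamma x] as the infimum over [y] of [g y + Q(x, y)]. On
   the ball of radius [r] the map [x |-> Q(x, y)] is Lipschitz with constant
   [K (1 + |y|)], and for [gamma < gamma0], [gamma0] any prox-radius of [g], the
   function [g y + Q(x, y)] dominates [1 + |y| - D] uniformly in [x]. So
   near-minimisers [y] stay in a fixed bounded set, and inserting a
   near-minimiser for [x] into the infimum at [z] gives the estimate. *)

Require Import Defs.
From HB Require Import structures.
From mathcomp Require Import all_boot all_order all_algebra.
From mathcomp Require Import all_classical all_reals all_analysis.
From mathcomp Require Import ring lra.
Set Implicit Arguments.
Unset Strict Implicit.
Unset Printing Implicit Defensive.
Import Order.TTheory GRing.Theory Num.Theory.
Import numFieldNormedType.Exports.
Local Open Scope classical_set_scope.
Local Open Scope ring_scope.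

(** * Euclidean inner product and norm *)

Lemma edotC (R : realType) (n : nat) (u v : 'rV[R]_n) : edot u v = edot v u.
Proof. by apply: eq_bigr => i _; rewrite mulrC. Qed.

Lemma edotDl (R : realType) (n : nat) (u v w : 'rV[R]_n) :
  edot (u + v) w = edot u w + edot v w.
Proof. by rewrite -big_split; apply: eq_bigr => i _; rewrite mxE mulrDl. Qed.

Lemma edotNl (R : realType) (n : nat) (u w : 'rV[R]_n) :
  edot (- u) w = - edot u w.
Proof. by rewrite -sumrN; apply: eq_bigr => i _; rewrite mxE mulNr. Qed.

Lemma edotZl (R : realType) (n : nat) (a : R) (u w : 'rV[R]_n) :
  edot (a *: u) w = a * edot u w.
Proof. by rewrite mulr_sumr; apply: eq_bigr => i _; rewrite mxE mulrA. Qed.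

Lemma edotDr (R : realType) (n : nat) (u v w : 'rV[R]_n) :
  edot w (u + v) = edot w u + edot w v.
Proof. by rewrite !(edotC w) edotDl. Qed.

Lemma edotNr (R : realType) (n : nat) (u w : 'rV[R]_n) :
  edot w (- u) = - edot w u.
Proof. by rewrite !(edotC w) edotNl. Qed.

Lemma edotZr (R : realType) (n : nat) (a : R) (u w : 'rV[R]_n) :
  edot w (a *: u) = a * edot w u.
Proof. by rewrite !(edotC w) edotZl. Qed.

Lemma edot_ge0 (R : realType) (n : nat) (u : 'rV[R]_n) : 0 <= edot u u.
Proof. by apply: sumr_ge0 => i _; rewrite -expr2 sqr_ge0. Qed.

Lemma edot_eq0 (R : realType) (n : nat) (u : 'rV[R]_n) :
  edot u u = 0 -> u = 0.
Proof.
move=> /eqP; rewrite psumr_eq0 => [/allP h|i _]; last by rewrite -expr2 sqr_ge0.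
apply/rowP => i; rewrite mxE; apply/eqP.
by move: (h i (mem_index_enum i)); rewrite mulf_eq0 orbb.
Qed.

Lemma enorm_ge0 (R : realType) (n : nat) (u : 'rV[R]_n) : 0 <= enorm u.
Proof. exact: sqrtr_ge0. Qed.

Lemma enorm_sqr (R : realType) (n : nat) (u : 'rV[R]_n) :
  enorm u ^+ 2 = edot u u.
Proof. by rewrite sqr_sqrtr // edot_ge0. Qed.

Lemma enormN (R : realType) (n : nat) (u : 'rV[R]_n) : enorm (- u) = enorm u.
Proof. by rewrite /enorm edotNl edotNr opprK. Qed.

Lemma enormZ (R : realType) (n : nat) (a : R) (u : 'rV[R]_n) :
  enorm (a *: u) = `|a| * enorm u.
Proof.
by rewrite /enorm edotZl edotZr mulrA -expr2 sqrtrM ?sqr_ge0 // sqrtr_sqr.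
Qed.

Lemma edot_cauchy_schwarz (R : realType) (n : nat) (u v : 'rV[R]_n) :
  `|edot u v| <= enorm u * enorm v.
Proof.
rewrite -(@ler_pXn2r _ 2) ?nnegrE ?mulr_ge0 ?enorm_ge0 ?normr_ge0 //.
rewrite real_normK ?num_real // exprMn !enorm_sqr.
have [/edot_eq0 ->|v0] := eqVneq (edot v v) 0.
  by rewrite -(scale0r (0 : 'rV[R]_n)) !edotZr !mul0r expr0n mulr0.
have v_gt0 : 0 < edot v v by rewrite lt_def v0 edot_ge0.
(* The squared norm of this multiple of the component of [u] orthogonal to [v] equals [edot v v]
   times the Gram determinant of [u] and [v], so that determinant is nonnegative. *)
have := edot_ge0 (edot v v *: u - edot u v *: v).
rewrite !(edotDl, edotDr, edotNl, edotNr, edotZl, edotZr) (edotC v u).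
rewrite (_ : _ + _ = edot v v * (edot u u * edot v v - edot u v ^+ 2)).
  by rewrite pmulr_rge0 // subr_ge0.
by ring.
Qed.

Lemma enormD (R : realType) (n : nat) (u v : 'rV[R]_n) :
  enorm (u + v) <= enorm u + enorm v.
Proof.
rewrite -(@ler_pXn2r _ 2) ?nnegrE ?addr_ge0 ?enorm_ge0 //.
rewrite sqrrD !enorm_sqr !(edotDl, edotDr) (edotC v u).
have := ler_norm (edot u v); have := edot_cauchy_schwarz u v.
by rewrite mulr2n; lra.
Qed.

(** * Infima of extended-real functions *)

Lemma ereal_inf_range_fin_num (R : realType) (T : Type) (h : T -> \bar R)
    (y0 : T) (D U : R) :
  (forall y, D%:E <= h y)%E -> (h y0 <= U%:E)%E ->
  ereal_inf (range h) \is a fin_num.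
Proof.
move=> lb ub; rewrite fin_numE -ltNye -ltey.
rewrite (lt_le_trans (ltNyr D)); last first.
  by apply: le_ereal_inf_tmp => _ [y _ <-].
apply: le_lt_trans (ltry U); apply: le_trans ub.
by apply: ereal_inf_lbound; exists y0.
Qed.

(* Near-minimisers [y] of [g + Qx] have [w y] bounded, hence are almost
   minimisers of [g + Qz]. *)
Lemma ereal_inf_perturb_le (R : realType) (T : Type) (g : T -> \bar R)
    (Qx Qz w : T -> R) (y0 : T) (d D U : R) :
  0 <= d -> (forall y, 0 <= w y) -> (forall y, g y != -oo)%E ->
  (forall y, Qz y <= Qx y + w y * d) ->
  (forall y, (w y - D)%:E <= g y + (Qx y)%:E)%E ->
  (g y0 + (Qx y0)%:E <= U%:E)%E ->
  (ereal_inf (range (fun y => g y + (Qz y)%:E)) <=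
   ereal_inf (range (fun y => g y + (Qx y)%:E)) + ((U + 1 + D) * d)%:E)%E.
Proof.
move=> d0 w0 gNy QQ coer bd.
set s := ereal_inf (range (fun y => g y + (Qx y)%:E))%E.
have s_le : (s <= U%:E)%E.
  by apply: le_trans bd; apply: ereal_inf_lbound; exists y0.
have s_fin : s \is a fin_num.
  apply: (@ereal_inf_range_fin_num _ _ _ y0 (- D) U) => // y.
  by apply: le_trans (coer y); rewrite lee_fin lerDr.
apply/lee_addgt0Pr => e e0.
(* Accuracy [e] serves the limit in [e]; accuracy 1 keeps the value at the near-minimiser below
   [U + 1], whence [w y <= U + 1 + D]. *)
have e1 : 0 < Num.min e 1 by rewrite lt_min e0 ltr01.
have [_ [y _ <-] ylt] := lb_ereal_inf_adherent e1 s_fin.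
apply: (@le_trans _ _ (g y + (Qz y)%:E)%E).
  by apply: ereal_inf_lbound; exists y.
move: ylt (coer y) s_le (gNy y); rewrite -/s -(fineK s_fin).
case: (g y) => [a||] //= ylt wle sU _.
move: ylt wle sU; rewrite !lte_fin !lee_fin => ylt wle sU.
have me : Num.min e 1 <= e by rewrite ge_min lexx.
have m1 : Num.min e 1 <= 1 by rewrite ge_min lexx orbT.
have := QQ y; have : w y * d <= (U + 1 + D) * d by apply: ler_wpM2r => //; lra.
by lra.
Qed.

(** * Increments of [f] along segments *)

Lemma is_derive_line (R : realType) (n : nat) (f : 'rV[R]_n -> R)
    (x v : 'rV[R]_n) (t : R) :
  differentiable f (x + t *: v) ->
  is_derive t 1 (fun s : R => f (x + s *: v)) (edot (grad f (x + t *: v)) v).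
Proof.
move=> df; rewrite edot_grad -deriveE //.
have eqq : (fun h : R => h^-1 *: (f (x + (h *: 1 + t) *: v) - f (x + t *: v)))
  = (fun h : R => h^-1 *: (f (h *: v + (x + t *: v)) - f (x + t *: v))).
  by apply/funext => h; rewrite [h *: 1]mulr1 scalerDl addrCA.
have dv : derivable f (x + t *: v) v by exact: diff_derivable.
by split; rewrite /derivable /derive /= eqq.
Qed.

(** Mean value theorem on the segment from [x] to [z]: the ball is convex, so the gradient bound
    applies at the intermediate point. *)
Lemma grad_bounded_lipschitz (R : realType) (n : nat) (f : 'rV[R]_n -> R)
    (r G : R) :
  (forall x, differentiable f x) ->
  (forall x, enorm x < r -> enorm (grad f x) <= G) ->
  forall x z, enorm x < r -> enorm z < r -> f z - f x <= G * enorm (z - x).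
Proof.
move=> df gG x z xr zr.
pose F := fun s : R => f (x + s *: (z - x)).
have dF (s : R) : is_derive s 1 F (edot (grad f (x + s *: (z - x))) (z - x)).
  exact: is_derive_line.
have cF : {within `[0, 1], continuous F}.
  apply: derivable_within_continuous => s _; by case: (dF s).
have [c /andP[]] := MVT_segment (@ler01 R) (fun s _ => dF s) cF.
rewrite !bnd_simp /F scale1r scale0r addr0 subr0 mulr1 subrKC => c0 c1 ->.
apply: le_trans (ler_norm _) _; apply: le_trans (edot_cauchy_schwarz _ _) _.
apply: ler_wpM2r; rewrite ?enorm_ge0 //; apply: gG.
rewrite (_ : x + c *: (z - x) = (1 - c) *: x + c *: z); last first.
  by rewrite scalerBr scalerBl scale1r addrA addrAC.
apply: le_lt_trans (enormD _ _) _.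
rewrite !enormZ !ger0_norm ?subr_ge0 //.
(* For [c < 1] strictness comes from [enorm x < r]; at [c = 1] that term vanishes and [enorm z < r]
   supplies it. *)
have [->|c_neq1] := eqVneq c 1; first by lra.
have c_lt1 : c < 1 by rewrite lt_neqAle c_neq1.
have : 0 < (1 - c) * (r - enorm x) by apply: mulr_gt0; lra.
have : 0 <= c * (r - enorm z) by apply: mulr_ge0; lra.
by lra.
Qed.

(** * The quadratic model and its two estimates *)

(** The real-valued part Q(x, y) of the infimand. The integer power makes it polynomial in inner
    products, within reach of [ring] and [lra]. *)
Definition fb_model (R : realType) (n : nat) (f : 'rV[R]_n -> R) (gamma : R)
    (x y : 'rV[R]_n) : R :=
  f x + edot (grad f x) (y - x) + 1 / (2 * gamma) * enorm (x - y) ^+ 2.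

Lemma hofbe_fb_model (R : realType) (n : nat) (f : 'rV[R]_n -> R)
    (g : 'rV[R]_n -> \bar R) (gamma : R) (x : 'rV[R]_n) :
  hofbe 2 f g gamma x =
  ereal_inf (range (fun y => g y + (fb_model f gamma x y)%:E)%E).
Proof.
apply: (congr1 (fun h => ereal_inf (range h))); apply/funext => y.
by rewrite powR_mulrn ?enorm_ge0 // addeAC -EFinD addeC.
Qed.

(** The gradient bound [G] is paid twice: for the increment of [f] and for moving the base point of
    the linear term. The change of gradient, paired with [y - z], and the change of the quadratic
    term both grow at most linearly in [enorm y]. *)
Lemma fb_model_lipschitz (R : realType) (n : nat) (f : 'rV[R]_n -> R)
    (L G r gamma : R) (x z y : 'rV[R]_n) :
  0 <= L -> 0 < gamma -> 0 <= G -> 0 <= r ->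
  enorm x <= r -> enorm z <= r -> enorm (grad f x) <= G ->
  enorm (grad f z - grad f x) <= L * enorm (z - x) ->
  f z - f x <= G * enorm (z - x) ->
  fb_model f gamma z y <= fb_model f gamma x y +
    (G *+ 2 + (L + gamma^-1) * (1 + r)) * (1 + enorm y) * enorm (z - x).
Proof.
move=> L0 g0 G0 r0 xr zr gxG gL fL; rewrite /fb_model !enorm_sqr.
set d := enorm (z - x) in gL fL *.
have d0 : 0 <= d by exact: enorm_ge0.
have Y0 : 0 <= enorm y by exact: enorm_ge0.
have i0 : 0 < gamma^-1 by rewrite invr_gt0.
have h1 : edot (grad f z) (y - z) - edot (grad f x) (y - x) =
    edot (grad f z - grad f x) (y - z) - edot (grad f x) (z - x).
  move: (grad f z) (grad f x) => a b.
  by rewrite !(edotDl, edotDr, edotNl, edotNr); ring.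
have h2 : edot (grad f z - grad f x) (y - z) <= L * d * (enorm y + r).
  apply: le_trans (ler_norm _) _; apply: le_trans (edot_cauchy_schwarz _ _) _.
  apply: ler_pM; [exact: enorm_ge0|exact: enorm_ge0|by []|].
  by apply: le_trans (enormD _ _) _; rewrite enormN lerD2l.
have h3 : - edot (grad f x) (z - x) <= G * d.
  apply: le_trans (ler_norm _) _; rewrite normrN.
  apply: le_trans (edot_cauchy_schwarz _ _) _.
  by apply: ler_wpM2r.
have h4 : edot (z - y) (z - y) - edot (x - y) (x - y) =
    edot (z - x) (z + x - 2 *: y).
  rewrite !(edotDl, edotDr, edotNl, edotNr, edotZr).
  by rewrite (edotC y z) (edotC y x) (edotC x z); ring.
have h5 : edot (z - x) (z + x - 2 *: y) <= d * (2 * (r + enorm y)).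
  apply: le_trans (ler_norm _) _; apply: le_trans (edot_cauchy_schwarz _ _) _.
  apply: ler_wpM2l => //; apply: le_trans (enormD _ _) _.
  rewrite enormN enormZ ger0_norm // mulrDr lerD2r.
  by apply: le_trans (enormD _ _) _; lra.
have h6 : 1 / (2 * gamma) * (edot (z - y) (z - y) - edot (x - y) (x - y)) <=
    gamma^-1 * d * (r + enorm y).
  rewrite h4 (_ : 1 / (2 * gamma) = gamma^-1 / 2); last by field; lra.
  have := ler_wpM2l (ltW i0) h5; lra.
have h7 : r + enorm y <= (1 + r) * (1 + enorm y).
  by have := mulr_ge0 r0 Y0; lra.
have h8 : L * d * (enorm y + r) <= L * d * ((1 + r) * (1 + enorm y)).
  by apply: ler_wpM2l; [exact: mulr_ge0|rewrite addrC].
have h9 : gamma^-1 * d * (r + enorm y) <= gamma^-1 * d * ((1 + r) * (1 + enorm y)).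
  by apply: ler_wpM2l => //; apply: mulr_ge0 => //; exact: ltW.
have h10 : 0 <= G * d * enorm y by do 2?apply: mulr_ge0.
lra.
Qed.

(** The subtracted quadratic is what prox-boundedness lets [g] lose. Since [gamma < gamma0], a
    positive multiple [c] of the square of [enorm y] survives and absorbs all linear terms. *)
Lemma fb_model_coercive (R : realType) (n : nat) (f : 'rV[R]_n -> R)
    (G F r gamma gamma0 : R) (x0 : 'rV[R]_n) :
  0 < gamma -> gamma < gamma0 -> 0 <= G -> 0 <= r ->
  exists D : R, forall x y, enorm x <= r -> enorm (grad f x) <= G ->
    - F <= f x ->
    1 + enorm y - D <=
      fb_model f gamma x y - 1 / (2 * gamma0) * enorm (x0 - y) ^+ 2.
Proof.
move=> g0 gg0 G0 r0.
have gg0' : 0 < gamma0 by lra.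
pose b := 1 / (2 * gamma0); pose c := 1 / (2 * gamma) - b.
have b0 : 0 < b by apply: divr_gt0; lra.
have c0 : 0 < c.
  by rewrite subr_gt0 /b !div1r ltf_pV2 ?posrE; lra.
(* [B] collects the coefficients of [enorm y]: from the left-hand side, the gradient term, and the
   quadratics centred at [x] and [x0]. *)
pose B := 1 + G + (b + c) * 2 * r + b * 2 * enorm x0.
exists (1 + F + G * r + b * enorm x0 ^+ 2 + B ^+ 2 / (4 * c)) => x y xr gG fF.
rewrite /fb_model -/b (_ : 1 / (2 * gamma) = b + c); last by rewrite /c addrC subrK.
have Y0 := enorm_ge0 y.
have e1 : - (G * (enorm y + r)) <= edot (grad f x) (y - x).
  rewrite lerNl; apply: le_trans (ler_norm _) _; rewrite normrN.
  apply: le_trans (edot_cauchy_schwarz _ _) _.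
  apply: ler_pM; [exact: enorm_ge0|exact: enorm_ge0|by []|].
  by apply: le_trans (enormD _ _) _; rewrite enormN lerD2l.
have e2 : enorm y ^+ 2 - 2 * r * enorm y <= enorm (x - y) ^+ 2.
  rewrite !enorm_sqr !(edotDl, edotDr, edotNl, edotNr) (edotC y x).
  have : edot x y <= r * enorm y.
    apply: le_trans (ler_norm _) _; apply: le_trans (edot_cauchy_schwarz _ _) _.
    exact: ler_wpM2r.
  by have := edot_ge0 x; lra.
have e3 : enorm (x0 - y) ^+ 2 <=
    enorm y ^+ 2 + 2 * enorm x0 * enorm y + enorm x0 ^+ 2.
  rewrite !enorm_sqr !(edotDl, edotDr, edotNl, edotNr) (edotC y x0).
  by have := edot_cauchy_schwarz x0 y; have := ler_norm (- edot x0 y);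
    rewrite normrN; lra.
have e4 : (b + c) * (enorm y ^+ 2 - 2 * r * enorm y) <=
  (b + c) * enorm (x - y) ^+ 2 by apply: ler_wpM2l => //; lra.
have e5 : b * enorm (x0 - y) ^+ 2 <=
  b * (enorm y ^+ 2 + 2 * enorm x0 * enorm y + enorm x0 ^+ 2).
  by apply: ler_wpM2l => //; lra.
(* completing the square in [c |y|^2 - B |y|] *)
have e6 : 0 <= c * enorm y ^+ 2 - B * enorm y + B ^+ 2 / (4 * c).
  rewrite (_ : _ + _ = c * (enorm y - B / (2 * c)) ^+ 2); last by field; lra.
  by rewrite mulr_ge0 ?sqr_ge0 // ltW.
have eB : B * enorm y =
  (1 + G + (b + c) * 2 * r + b * 2 * enorm x0) * enorm y by [].
by lra.
Qed.

(** * Lipschitz estimate for the envelope on a ball *)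

Theorem corollary21 (R : realType) (n : nat) (p : R) (hp : p = 2)
    (f : 'rV[R]_n -> R) (g : 'rV[R]_n -> \bar R) (L : R)
    (g_proper : proper_efun g)
    (g_lsc : lower_semicontinuous g)
    (g_prox : ho_prox_bounded p g)
    (f_diff : forall x, differentiable f x)
    (f_grad : grad_lipschitz L f) :
  forall r : R, 0 < r ->
    exists gbar : R, [/\ 0 < gbar, (gbar%:E < prox_threshold p g)%E &
      forall gamma : R, 0 < gamma -> gamma < gbar ->
        exists2 C : R, 0 < C &
          forall x z : 'rV[R]_n, eball 0 r x -> eball 0 r z ->
            (`|hofbe p f g gamma z - hofbe p f g gamma x|
               <= (C * enorm (z - x))%:E)%E].
Proof.
move=> r r0; subst p.
case: g_proper => gNy [y0 gy0].
case: g_prox => gamma0 /[dup] prox_gamma0 [gamma0_gt0 [x0 infx0]].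
(* The threshold may equal [gamma0]; halving keeps [gbar] strictly below it. *)
exists (gamma0 / 2); split; first by lra.
  apply: (@lt_le_trans _ _ gamma0%:E); first by rewrite lte_fin; lra.
  by apply: ereal_sup_ubound; exists gamma0.
move=> gamma gamma_gt0 gamma_lt.
have gamma_lt0 : gamma < gamma0 by lra.
have [m gm] : exists m : R, forall y,
    (m%:E <= g y + (1 / (2 * gamma0) * enorm (x0 - y) ^+ 2)%:E)%E.
  have lb y : (moreau_inf 2 g gamma0 x0 <=
      g y + (1 / (2 * gamma0) * enorm (x0 - y) ^+ 2)%:E)%E.
    apply: ereal_inf_lbound; exists y => //.
    by rewrite powR_mulrn ?enorm_ge0.
  case: (moreau_inf 2 g gamma0 x0) infx0 lb => [m||] // _ lb; first by exists m.
  (* An infimum equal to [+oo] forces every value to be [+oo], so 0 is a lower bound. *)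
  by exists 0 => y; apply: le_trans (lb y); exact: leey.
(* The sign of [L] is not prescribed (in dimension 0 it may be negative), while the estimates
   multiply by a nonnegative constant. *)
pose L' := `|L|; have L'0 : 0 <= L' by exact: normr_ge0.
have fL x y : enorm (grad f x - grad f y) <= L' * enorm (x - y).
  by apply: le_trans (f_grad x y) _; rewrite ler_wpM2r ?enorm_ge0 ?ler_norm.
pose G := enorm (grad f 0) + L' * r.
have G0 : 0 <= G by rewrite addr_ge0 ?mulr_ge0 ?enorm_ge0 // ltW.
have gG x : enorm x < r -> enorm (grad f x) <= G.
  move=> xr; rewrite -[grad f x](subrKC (grad f 0)).
  apply: le_trans (enormD _ _) _; rewrite lerD2l.
  apply: le_trans (fL _ _) _; rewrite subr0; apply: ler_wpM2l => //; exact: ltW.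
have fLip := grad_bounded_lipschitz f_diff gG.
have enorm0 : enorm (0 : 'rV[R]_n) = 0.
  by rewrite -(scale0r 0) enormZ normr0 mul0r.
have fF x : enorm x < r -> - (G * r - f 0) <= f x.
  move=> xr; have := fLip x 0 xr; rewrite enorm0 sub0r enormN => /(_ r0).
  have : G * enorm x <= G * r by apply: ler_wpM2l => //; exact: ltW.
  by lra.
have [D coer] :=
  fb_model_coercive f (G * r - f 0) x0 gamma_gt0 gamma_lt0 G0 (ltW r0).
pose K := G *+ 2 + (L' + gamma^-1) * (1 + r).
have K0 : 0 < K.
  rewrite /K ltr_wpDl ?mulrn_wge0 // mulr_gt0 //; last by rewrite addr_gt0.
  by rewrite ltr_wpDl ?invr_gt0.
have lipK x z y : enorm x < r -> enorm z < r -> fb_model f gamma z y <=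
    fb_model f gamma x y + K * (1 + enorm y) * enorm (z - x).
  move=> xr zr; apply: fb_model_lipschitz => //; try exact: ltW.
  - exact: gG.
  - exact: fLip.
(* [U] bounds the infimand at [y0] for all [x] in the ball: its value at [x = 0] plus the variation
   over a distance at most [r]. [M] dominates the bound on [1 + enorm y] at near-minimisers and is
   made positive. *)
pose U := fine (g y0) + fb_model f gamma 0 y0 + K * (1 + enorm y0) * r.
pose M := `|U + 1 + (D - m)| + 1.
have M0 : 0 < M by rewrite ltr_wpDl.
have lower x y : enorm x < r ->
    ((1 + enorm y - (D - m))%:E <= g y + (fb_model f gamma x y)%:E)%E.
  move=> xr; have := coer x y (ltW xr) (gG x xr) (fF x xr).
  move: (gm y) (gNy y); case: (g y) => [a||] //=.
    by rewrite -!EFinD !lee_fin; lra.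
  by move=> _ _ _; rewrite leey.
have upper x : enorm x < r -> (g y0 + (fb_model f gamma x y0)%:E <= U%:E)%E.
  move=> xr; rewrite -(fineK gy0) -EFinD lee_fin /U -addrA lerD2l.
  apply: le_trans (lipK 0 x y0 _ xr) _; rewrite ?enorm0 // lerD2l.
  rewrite subr0; apply: ler_wpM2l; last exact: ltW.
  by apply: mulr_ge0; [exact: ltW|rewrite addr_ge0 ?enorm_ge0].
have half x z : enorm x < r -> enorm z < r ->
    (hofbe 2 f g gamma z <= hofbe 2 f g gamma x + (M * K * enorm (z - x))%:E)%E.
  move=> xr zr; rewrite !hofbe_fb_model.
  have d0 : 0 <= K * enorm (z - x) by rewrite mulr_ge0 ?enorm_ge0 // ltW.
  apply: le_trans.
    apply: (@ereal_inf_perturb_le _ _ g (fb_model f gamma x) (fb_model f gamma z)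
      (fun y => 1 + enorm y) y0 _ (D - m) U d0) => [y|//|y|y|].
    - by rewrite addr_ge0 ?enorm_ge0.
    - by apply: le_trans (lipK x z y xr zr) _; rewrite mulrCA mulrA.
    - exact: lower.
    - exact: upper.
  rewrite leeD2l // lee_fin -mulrA ler_wpM2r //.
  by apply: le_trans (ler_norm _) _; rewrite lerDl.
exists (M * K); first exact: mulr_gt0.
move=> x z; rewrite /eball/= !subr0 => xr zr.
(* Finiteness turns the two one-sided estimates, with [x] and [z] exchanged, into a real inequality
   for the absolute difference. *)
have fin u : enorm u < r -> hofbe 2 f g gamma u \is a fin_num.
  move=> ur; rewrite hofbe_fb_model.
  apply: (@ereal_inf_range_fin_num _ _ _ y0 (- (D - m)) U) => [y|];
    last exact: upper.
  apply: le_trans (lower u y ur); rewrite lee_fin lerDr.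
  by rewrite addr_ge0 ?enorm_ge0.
move: (half x z xr zr) (half z x zr xr) (fin x xr) (fin z zr).
rewrite -(opprB z x) enormN.
case: (hofbe 2 f g gamma x) => // a; case: (hofbe 2 f g gamma z) => // b.
rewrite -!EFinD !lee_fin => h1 h2 _ _.
by rewrite ler_norml; apply/andP; split; lra.
Qed.
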